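(* Let $\mathbb{F}_\ell$ be a finite field, $n\ge1$ an integer, and let $p:\mathfrak{gl}_n\to\underline{\mathfrak c}$ be the Chevalley map over $\mathbb{F}_\ell$. There is a constant $C$ such that for every $x\in\underline{\mathfrak c}$ and every $m\in\mathbb{N}$ $$\dim \mathcal{J}_m(p^{-1}(x))<m\dim(p^{-1}(x))+C .$$
   Context: All varieties are over $\mathbb{F}_\ell$. $\mathfrak{gl}_n$ is the variety of $n\times n$ matrices; $\underline{\mathfrak c}\cong\mathbb{A}^n$ is the affine space of monic polynomials of degree $n$; $p$ sends a matrix to its characteristic polynomial. The fiber $p^{-1}(x)$ is taken in the category of schemes. $\mathcal{J}_m(\mathbf{X})$ denotes the $m$-th jet scheme of $\mathbf{X}$ (representing $A\mapsto\mathbf{X}(A[t]/(t^{m+1}))$); for a fiber $p^{-1}(x)$ it is taken over the field of definition of the point $x$. *)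

(* Defs.v *)
From HB Require Import structures.
From mathcomp Require Import all_boot all_order all_algebra.
From mathcomp Require Import ring_quotient fraction mpoly.
From mathcomp Require Import boolp classical_sets constructive_ereal.

Set Implicit Arguments.
Unset Strict Implicit.
Unset Printing Implicit Defensive.

Import GRing.Theory Num.Theory.
Local Open Scope ring_scope.
Local Open Scope quotient_scope.

(* The quotient of a commutative ring by a prime ideal is an integral domain.
   The library only provides its nonzero commutative ring structure: units and
   inverses are obtained here by choice. *)
Section PrimeQuotient.
Variables (R : comNzRingType) (P : prime_idealr R).
Local Notation Q := {ideal_quot P}.

Definition pquot_unit : pred Q := fun a => `[< exists b : Q, b * a = 1 >].
Definition pquot_inv (a : Q) : Q := xget a [set b : Q | b * a = 1].

Lemma pquot_mulVr : {in pquot_unit, left_inverse 1 pquot_inv *%R}.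
Proof.
by move=> a /asboolP[b ba1]; rewrite /pquot_inv; case: xgetP => // /(_ b).
Qed.

Lemma pquot_unitP (a b : Q) : b * a = 1 -> pquot_unit a.
Proof. by move=> ba1; apply/asboolP; exists b. Qed.

Lemma pquot_inv_out : {in [predC pquot_unit], pquot_inv =1 id}.
Proof.
move=> a /asboolPn na; rewrite /pquot_inv.
by case: xgetP => // b _ /= ba1; case: na; exists b.
Qed.

HB.instance Definition _ := GRing.ComNzRing_hasMulInverse.Build Q
  pquot_mulVr pquot_unitP pquot_inv_out.

HB.instance Definition _ := GRing.ComUnitRing_isIntegral.Build Q
  (@Quotient.rquot_IdomainAxiom R P).

End PrimeQuotient.

(* The points of Spec R are the prime ideals x of R; this is kappa(x). That
   prime_idealr bundles a boolean predicate is no restriction in the presence of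
   classical logic. *)
Definition residue_field (R : comNzRingType) (x : prime_idealr R) : fieldType :=
  {fraction {ideal_quot x}}.

Definition residue (R : comNzRingType) (x : prime_idealr R) :
    {rmorphism R -> residue_field x} :=
  (@tofrac {ideal_quot x}) \o \pi_{ideal_quot x}.

(* The closed subscheme of affine N-space over k cut out by a finite family of
   equations, i.e. Spec of k[X_0, ..., X_(N-1)] modulo the ideal they
   generate. *)
Record affine_scheme (k : fieldType) := AffineScheme {
  ambient : nat;
  equations : seq {mpoly k[ambient]}
}.

Definition is_point (k : fieldType) (X : affine_scheme k) (A : comNzRingType)
    (phi : {rmorphism k -> A}) (v : 'I_(ambient X) -> A) : Prop :=
  forall f, f \in equations X -> mmap phi v f = 0.
Arguments is_point {k} X {A} phi v.

(* The underlying space of X, viewed inside that of affine space: the prime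
   ideals containing the equations. *)
Definition carrier (k : fieldType) (X : affine_scheme k) :
    set (prime_idealr {mpoly k[ambient X]}) :=
  [set P | {subset equations X <= (P : pred _)}].
Arguments carrier {k} X _.

(* Chains P 0 < ... < P d of length d in the carrier of X. *)
Definition has_chain (k : fieldType) (X : affine_scheme k) (d : nat) : Prop :=
  exists P : nat -> prime_idealr {mpoly k[ambient X]},
    (forall i, (i <= d)%N -> carrier X (P i)) /\
    (forall i, (i < d)%N ->
       {subset (P i : pred _) <= (P i.+1 : pred _)} /\
       ~ {subset (P i.+1 : pred _) <= (P i : pred _)}).

(* Krull dimension; the empty scheme has dimension -oo. *)
Definition krull_dim (k : fieldType) (X : affine_scheme k) : \bar int :=
  supremum -oo%E [set d%:Z%:E | d in has_chain X].

(* The universal m-jet in affine N-space: the variable with index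
   mxvec_index j i is the coefficient of t^i in the j-th coordinate. *)
Definition universal_jet (k : fieldType) (N m : nat) (j : 'I_N) :
    {poly {mpoly k[N * m.+1]}} :=
  \sum_(i < m.+1) 'X_(mxvec_index j i) *: 'X^i.

Definition jet_expand (k : fieldType) (N m : nat) (f : {mpoly k[N]}) :
    {poly {mpoly k[N * m.+1]}} :=
  mmap (polyC \o @mpolyC (N * m.+1) k) (@universal_jet k N m) f.

Definition jet_scheme (k : fieldType) (m : nat) (X : affine_scheme k) :
    affine_scheme k :=
  @AffineScheme k (ambient X * m.+1)
    [seq (jet_expand m f)`_i | f <- equations X, i <- iota 0 m.+1].

(* jet_scheme represents A |-> X(A[t]/(t^(m+1))): a tuple w of coordinates in A
   corresponds to the tuple of truncated polynomials sum_i w_(j,i) t^i. *)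
Lemma jet_schemeP (k : fieldType) (m : nat) (X : affine_scheme k)
    (A : comNzRingType) (phi : {rmorphism k -> A})
    (w : 'I_(ambient X * m.+1) -> A) :
  is_point (jet_scheme m X) phi w <->
  forall f, f \in equations X ->
    take_poly m.+1
      (mmap (polyC \o phi)
         (fun j => \sum_(i < m.+1) w (mxvec_index j i) *: 'X^i) f) = 0.
Proof.
have E f : mmap (polyC \o phi)
      (fun j => \sum_(i < m.+1) w (mxvec_index j i) *: 'X^i) f
    = map_poly (mmap phi w) (jet_expand m f).
  rewrite /jet_expand [in LHS]/mmap [mmap _ (universal_jet _ _) _]/mmap.
  rewrite rmorph_sum; apply: eq_bigr => a _.
  rewrite rmorphM /= map_polyC /= mmapC; congr (_ * _).
  rewrite /mmap1 rmorph_prod; apply: eq_bigr => j _.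
  rewrite rmorphXn /=; congr (_ ^+ _); rewrite raddf_sum; apply: eq_bigr => i _.
  by rewrite /= map_polyZ /= map_polyXn /= mmapX mmap1U.
split=> [H f fX | H _ /allpairsP[[f i] [fX im ->]]].
  apply/polyP => i; rewrite coef_take_poly coef0 E coef_map /=.
  case: ifP => // lim; apply: (H (jet_expand m f)`_i).
  apply/allpairsP; exists (f, i); split=> //.
  by rewrite mem_iota.
move: im; rewrite mem_iota add0n => /andP[_ im].
by have /polyP/(_ i) := H f fX; rewrite coef_take_poly im coef0 E coef_map.
Qed.

(* The fibre over a point x of affine r-space of the morphism from affine
   N-space with components g: its base change along Spec kappa(x). *)
Definition fiber (k : fieldType) (N r : nat) (g : 'I_r -> {mpoly k[N]})
    (x : prime_idealr {mpoly k[r]}) : affine_scheme (residue_field x) :=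
  @AffineScheme (residue_field x) N
    [seq map_mpoly (residue x \o @mpolyC r k) (g i) - (residue x 'X_i)%:MP | i : 'I_r].

Definition generic_matrix (k : fieldType) (n : nat) : 'M[{mpoly k[n * n]}]_n :=
  \matrix_(i, j) 'X_(mxvec_index i j).

(* Monic polynomials of degree n are identified with affine n-space through
   their coefficients of degree 0, ..., n - 1. *)
Definition chevalley (k : fieldType) (n : nat) (i : 'I_n) : {mpoly k[n * n]} :=
  (char_poly (generic_matrix k n))`_i.
Arguments chevalley : clear implicits.

(* Main.v *)
(* Lower bound on the fiber: let C be the companion matrix of the polynomial x
   and g a matrix with first row e_0 and n^2 - n free entries Y in the other rows.
   The closure of the set of conjugates g^-1 C g has dimension n^2 - n, because
   row i of g is e_0 (g^-1 C g)^i; specializing the Y's one after the other to the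
   entries of the identity matrix gives an explicit chain of primes of this length.

   Upper bound on the jets: give the entry (i, j), and all its jet coefficients,
   the weight c0 - (i + j)^2 with c0 large. The top weight part of the coefficient
   of degree n - c of the characteristic polynomial is then, up to sign, the single
   antidiagonal product prod_(i < c) a_(i, c-1-i). These products involve disjoint
   sets of variables, and modulo t^(m+1) each product of c arcs cuts out a subset of
   codimension m + 1: the leading forms already force the dimension to be at
   most (n^2 - n)(m + 1). Since passing to leading forms preserves the Hilbert
   function, this bounds all fibers at once. Krull dimension is compared with the
   Hilbert function through the elements separating consecutive primes of a chain,
   which are algebraically independent modulo the first one. *)
Require Import Defs.
From HB Require Import structures.
From mathcomp Require Import all_boot all_order all_algebra perm.
From mathcomp Require Import ring_quotient fraction mpoly.
From mathcomp Require Import boolp classical_sets constructive_ereal.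
From mathcomp Require Import zify.

Set Implicit Arguments.
Unset Strict Implicit.
Unset Printing Implicit Defensive.

Import Order.TTheory GRing.Theory Num.Theory.
Local Open Scope ring_scope.

(** * Leading forms for a weighted degree *)

Definition weight (N : nat) (w : 'I_N -> nat) (m : 'X_{1..N}) : nat :=
  (\sum_i m i * w i)%N.

Section WeightMeasure.
Variables (N : nat) (w : 'I_N -> nat).

Fact weight0 : weight w 0%MM = 0%N.
Proof. by rewrite /weight big1 // => i _; rewrite mnm0E. Qed.

Fact weightD : {morph weight w : m1 m2 / (m1 + m2)%MM >-> (m1 + m2)%N}.
Proof.
move=> m1 m2; rewrite /weight -big_split /=; apply: eq_bigr => i _.
by rewrite mnmDE mulnDl.
Qed.

HB.instance Definition _ := isMeasure.Build N (weight w) weight0 weightD.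

End WeightMeasure.

Section Measure.
Variables (k : fieldType) (N : nat) (mf : measure N).
Implicit Types (p q : {mpoly k[N]}) (d e : nat).
Local Notation mm := (mmeasure mf).

(** [mmeasure] is one more than the largest weight of a monomial, and 0 at the zero polynomial.
    Hence a bound [d.+1] means weight at most [d], while a bound [d] means weight strictly below
    [d]. *)
Lemma mmeasure_leP p d :
  reflect (forall m, m \in msupp p -> (mf m < d)%N) (mm p <= d)%N.
Proof.
rewrite mmeasureE; apply: (iffP idP) => [le m mp | H].
  by apply: leq_trans le; rewrite (bigD1_seq m) //= leq_maxl.
by rewrite big_seq; elim/big_ind: _ => // x y; rewrite geq_max => -> ->.
Qed.

Lemma mmeasureD_leq p q d : (mm p <= d)%N -> (mm q <= d)%N -> (mm (p + q) <= d)%N.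
Proof.
by move=> pd qd; apply: leq_trans (mmeasureD_le _ _ _) _; rewrite geq_max pd.
Qed.

Lemma mmeasure_sum_leq (T : Type) (r : seq T) (Q : pred T) (F : T -> {mpoly k[N]}) d :
  (forall i, Q i -> (mm (F i) <= d)%N) -> (mm (\sum_(i <- r | Q i) F i) <= d)%N.
Proof.
move=> H; elim/big_ind: _ => //; first by rewrite mmeasure0.
by move=> p q; apply: mmeasureD_leq.
Qed.

Lemma mmeasureM_leq p q d e :
  (mm p <= d)%N -> (mm q <= e.+1)%N -> (mm (p * q) <= d + e)%N.
Proof.
move=> /mmeasure_leP pd /mmeasure_leP qe; apply/mmeasure_leP => m.
move=> /msuppM_le/allpairsP[[m1 m2] /= [/pd m1d /qe m2e ->]].
by rewrite mfD; lia.
Qed.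

Lemma mmeasure_prod_leq (T : finType) (Q : pred T) (F : T -> {mpoly k[N]}) (d : T -> nat) :
  (forall i, Q i -> (mm (F i) <= (d i).+1)%N) ->
  (mm (\prod_(i | Q i) F i) <= (\sum_(i | Q i) d i).+1)%N.
Proof.
move=> H; elim/big_ind2: _ => //; first by rewrite mmeasure1.
by move=> p1 d1 p2 d2 le1 le2; rewrite -addSn; apply: mmeasureM_leq.
Qed.

Lemma mmeasureXn_leq p d i : (mm p <= d.+1)%N -> (mm (p ^+ i) <= (i * d).+1)%N.
Proof.
move=> pd; elim: i => [|i IH]; first by rewrite mmeasure1.
by rewrite exprSr mulSnr -addSn; apply: mmeasureM_leq.
Qed.

End Measure.

Section LeadingForms.
Variables (k : fieldType) (N : nat) (mf : measure N) (P : idealr {mpoly k[N]}).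
Implicit Types (h q : {mpoly k[N]}) (d e : nat).
Local Notation mm := (mmeasure mf).

(* For [h] of weight at most [d], this says that the component of degree [d] of
   [h] vanishes or is the leading form of an element of [P]. *)
Definition leads d h : Prop :=
  exists2 f, f \in (P : pred _) & (mm (f - h) <= d)%N.

Lemma leads_small d h : (mm h <= d)%N -> leads d h.
Proof. by move=> hd; exists 0; rewrite ?idealr0 // sub0r mmeasureN. Qed.

Lemma leadsD d h1 h2 : leads d h1 -> leads d h2 -> leads d (h1 + h2).
Proof.
move=> [f1 f1P le1] [f2 f2P le2]; exists (f1 + f2); first exact: rpredD.
by rewrite opprD addrACA; apply: mmeasureD_leq.
Qed.

Lemma leadsMl d e q h : (mm q <= e.+1)%N -> leads d h -> leads (d + e) (q * h).
Proof.
move=> qe [f fP le]; exists (q * f); first exact: idealMr.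
by rewrite -mulrBr mulrC; apply: mmeasureM_leq.
Qed.

Lemma leads_sum (T : Type) (r : seq T) (Q : pred T) F d :
  (forall i, Q i -> leads d (F i)) -> leads d (\sum_(i <- r | Q i) F i).
Proof.
move=> H; elim/big_ind: _ => //; last exact: leadsD.
by apply: leads_small; rewrite mmeasure0.
Qed.

(** In weight [d], this is the radical of the ideal of leading forms. The radical is needed because
    products of arcs are reached only through their powers. *)
Definition nil_leads d h : Prop :=
  (mm h <= d.+1)%N /\ exists M, leads (M * d) (h ^+ M).

Lemma leads_nil d h : (mm h <= d.+1)%N -> leads d h -> nil_leads d h.
Proof. by move=> hd ld; split=> //; exists 1%N; rewrite mul1n expr1. Qed.

Lemma nil_leadsMl d e q h :
  (mm q <= e.+1)%N -> nil_leads d h -> nil_leads (d + e) (q * h).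
Proof.
move=> qe [hd [M hM]]; split; first by rewrite mulrC -addSn; apply: mmeasureM_leq.
exists M; rewrite exprMn mulnDr; apply: leadsMl => //; exact: mmeasureXn_leq.
Qed.

Lemma nil_leadsX d h i : (mm h <= d.+1)%N -> nil_leads (i * d) (h ^+ i) -> nil_leads d h.
Proof.
move=> hd [_ [M hM]]; split=> //; exists (i * M)%N.
by rewrite exprM mulnAC mulnC.
Qed.

(** In each binomial term of the power [M1 + M2], either [h1] has exponent at least [M1] or [h2] has
    exponent at least [M2]. *)
Lemma nil_leadsD d h1 h2 : nil_leads d h1 -> nil_leads d h2 -> nil_leads d (h1 + h2).
Proof.
move=> [h1d [M1 le1]] [h2d [M2 le2]]; split; first exact: mmeasureD_leq.
exists (M1 + M2)%N; rewrite exprDn; apply: leads_sum => -[i /= ilt] _.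
rewrite -mulr_natl mulrA.
have nat_le c : (mm (c%:R : {mpoly k[N]}) <= 1)%N.
  by rewrite -mpolyC_nat mmeasureC; case: (_ == _).
have [leM1 | ltM1] := leqP M1 (M1 + M2 - i)%N.
- rewrite -(subnK leM1) exprD.
  rewrite (_ : _ * _ * _ = ('C(M1 + M2, i)%:R * h1 ^+ (M1 + M2 - i - M1) * h2 ^+ i)
    * h1 ^+ M1); last by rewrite -!mulrA; congr (_ * (_ * _)); rewrite mulrC.
  rewrite (_ : ((M1 + M2) * d)%N = (M1 * d + ((M1 + M2 - i - M1) * d + i * d))%N);
    last by rewrite -!mulnDl; congr (_ * _)%N; lia.
  apply: leadsMl => //; rewrite -addSn; apply: mmeasureM_leq;
    last exact: mmeasureXn_leq.
  by rewrite -(add0n ((_ - _) * _)%N) -addSn; apply: mmeasureM_leq => //;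
    apply: mmeasureXn_leq.
- have leM2 : (M2 <= i)%N by lia.
  rewrite -(subnK leM2) exprD mulrA.
  set a := (M1 + M2 - (i - M2 + M2))%N.
  rewrite (_ : ((M1 + M2) * d)%N = (M2 * d + (a * d + (i - M2) * d))%N);
    last by rewrite -!mulnDl /a; congr (_ * _)%N; lia.
  apply: leadsMl => //; rewrite -addSn; apply: mmeasureM_leq;
    last exact: mmeasureXn_leq.
  by rewrite -(add0n (a * _)%N) -addSn; apply: mmeasureM_leq => //;
    apply: mmeasureXn_leq.
Qed.

Lemma nil_leads_sum (T : Type) (r : seq T) (Q : pred T) F d :
  (forall i, Q i -> nil_leads d (F i)) -> nil_leads d (\sum_(i <- r | Q i) F i).
Proof.
move=> H; elim/big_ind: _ => //; last exact: nil_leadsD.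
by apply: leads_nil; [|apply: leads_small]; rewrite mmeasure0.
Qed.

End LeadingForms.

(** * Chains of primes and Hilbert functions *)

Section ChainBound.
Variables (k : fieldType) (N : nat).
Implicit Types (p q y : {mpoly k[N]}).

(** Pick [f] in [P 1] outside [P 0], and recurse along the shifted chain. The family [y] consists of
    the products of powers of these separating elements with exponents below [s]. In a relation
    modulo [P 0], the lowest power of [f] cancels by primality; reduction modulo [P 1], which kills
    [f], then leaves a relation to which the induction hypothesis applies. *)
Lemma chain_independent (mf : measure N) e (P : nat -> prime_idealr {mpoly k[N]}) :
  (forall i, (i < e)%N ->
     {subset (P i : pred _) <= (P i.+1 : pred _)} /\
     ~ {subset (P i.+1 : pred _) <= (P i : pred _)}) ->
  exists c, forall s, exists (T : finType) (y : T -> {mpoly k[N]}),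
    [/\ #|T| = (s ^ e)%N, forall t, (mmeasure mf (y t) <= (c * s).+1)%N &
      forall a : T -> k, \sum_t a t *: y t \in (P 0 : pred _) -> forall t, a t = 0].
Proof.
elim: e P => [|e IH] P chainP.
  exists 0%N => s; exists unit, (fun=> 1); split.
  - by rewrite card_unit.
  - by move=> t; rewrite mmeasure1.
  - move=> a; rewrite (bigD1 tt) //= big1 => [|[] //]; rewrite addr0 => aP [].
    apply: contraFeq (idealr1 (P 0)) => anz.
    rewrite -(scale1r 1) -(mulVf anz) -scalerA -mul_mpolyC.
    exact: idealMr.
have [|c' IHc] := IH (fun i => P i.+1) _; first by move=> i lti; apply: chainP.
have [sub01 nsub10] := chainP 0 isT.
have [f fP1 fP0] : exists2 f, f \in (P 1 : pred _) & f \notin (P 0 : pred _).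
  by apply: contra_notP nsub10 => H f fP1; apply: contra_notT H; exists f.
exists (mmeasure mf f + c')%N => s.
have [T [y [cardT le_y indep]]] := IHc s.
exists ('I_s * T)%type, (fun t : 'I_s * T => f ^+ t.1 * y t.2); split.
- by rewrite card_prod card_ord cardT expnS.
- move=> [i t] /=; rewrite mulnDl -addSn; apply: mmeasureM_leq => //.
  have lef : (mmeasure mf f <= (mmeasure mf f).+1)%N by lia.
  apply: leq_trans (mmeasureXn_leq i lef) _.
  by rewrite ltnS mulnC leq_mul2l ltnW ?orbT.
move=> a; rewrite (eq_bigr (fun t => a (t.1, t.2) *: (f ^+ t.1 * y t.2))); last by case.
rewrite -(pair_bigA _ (fun (i : 'I_s) t => a (i, t) *: (f ^+ i * y t))) /=.
move=> aP; suff H (i : 'I_s) t : a (i, t) = 0 by case.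
have [j] := ubnP (i : nat); elim: j i t => // j IHj i t; rewrite ltnS => leij.
have := aP; rewrite (bigID (fun l : 'I_s => (l < i)%N)) /= big1; last first.
  move=> l lti; rewrite big1 // => u _; rewrite IHj ?scale0r //.
  exact: leq_trans lti leij.
rewrite add0r.
rewrite (eq_bigr (fun l : 'I_s =>
    f ^+ i * (f ^+ (l - i) * \sum_u a (l, u) *: y u))); last first.
  move=> l; rewrite -leqNgt => leil; rewrite mulrA -exprD subnKC // mulr_sumr.
  by apply: eq_bigr => u _; rewrite scalerAr.
rewrite -mulr_sumr prime_idealrM => /orP[fiP0|].
  suff : f \in (P 0 : pred _) by rewrite (negPf fP0).
  elim: (i : nat) fiP0 => [|l IHl]; first by rewrite expr0 idealr1.
  by rewrite exprS prime_idealrM => /orP[].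
move=> /sub01; rewrite (bigD1 i) /= ?ltnn // subnn mul1r rpredDr; last first.
  apply: rpred_sum => l /andP[]; rewrite -leqNgt => leil neli.
  rewrite mulrC; apply: idealMr; rewrite -(@prednK (l - i)) ?exprSr; last first.
    by rewrite subn_gt0 ltn_neqAle leil andbT eq_sym.
  exact: idealMr.
by move=> /(indep (fun u => a (i, u))); apply.
Qed.

(** * Standard monomials and the growth of the quotient by a prime *)

Variables (w : 'I_N -> nat) (P : prime_idealr {mpoly k[N]}) (D : nat).
Hypothesis w_gt0 : forall i, (0 < w i)%N.
Local Notation mm := (mmeasure (weight w)).

Lemma leq_weight (m : 'X_{1..N}) i : (m i <= weight w m)%N.
Proof.
rewrite /weight (bigD1 i) //=; apply: leq_trans (leq_addr _ _).
by rewrite leq_pmulr.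
Qed.

Hypothesis leadP : forall S : {set 'I_N}, (D < #|S|)%N ->
  exists m : 'X_{1..N}, (forall i, i \notin S -> m i = 0%N) /\
    leads (weight w) P (weight w m) 'X_[m].

(** These monomials represent the quotient by [P]. At most [D] exponents are free to grow, so their
    number grows at most like a polynomial of degree [D] in the weight. *)
Definition standard M (m : 'X_{1..N}) := (#|[set i | (M <= m i)%N]| <= D)%N.

(** Choose one monomial from [leadP] for each of the finitely many sets [S], and let [M] exceed all
    their exponents. A nonstandard monomial is then divisible by the one chosen for its set of large
    exponents. *)
Lemma nonstandard_lead : exists2 M, (0 < M)%N & forall m, ~~ standard M m ->
  leads (weight w) P (weight w m) 'X_[m].
Proof.
have /fin_all_exists[mu muP] (S : {set 'I_N}) : exists m : 'X_{1..N}, (D < #|S|)%N ->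
    (forall i, i \notin S -> m i = 0%N) /\ leads (weight w) P (weight w m) 'X_[m].
  have [ltD|leD] := ltnP D #|S|; last by exists 0%MM.
  by have [m mP] := leadP ltD; exists m.
exists (\max_S \max_i mu S i).+1 => // m; rewrite /standard -ltnNge => /muP[mu0 lead].
set S := [set i | _] in mu0 lead.
have le_mu : (mu S <= m)%MM.
  apply/mnm_lepP => i; have [|/mu0-> //] := boolP (i \in S).
  rewrite inE; apply: leq_trans; apply: leqW.
  by rewrite (bigD1 S) //= leq_max (bigD1 i) //= leq_maxl.
rewrite -(submK le_mu) mpolyXD weightD addnC; apply: leadsMl => //.
by rewrite mmeasureX.
Qed.

(** Division by leading forms: a nonstandard monomial is congruent modulo [P] to a polynomial of
    strictly smaller weight, so induction on the weight applies. *)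
Lemma standard_span M :
  (forall m, ~~ standard M m -> leads (weight w) P (weight w m) 'X_[m]) ->
  forall d p, (mm p <= d)%N -> exists q, [/\ (mm q <= d)%N,
    forall m, m \in msupp q -> standard M m & p - q \in (P : pred _)].
Proof.
move=> nonstd; elim=> [|d IH] p.
  rewrite leqn0 mmeasure_poly_eq0 => /eqP->; exists 0.
  by rewrite mmeasure0 msupp0 subrr idealr0.
pose good p := exists q, [/\ (mm q <= d.+1)%N,
    forall m, m \in msupp q -> standard M m & p - q \in (P : pred _)].
have good0 : good 0 by exists 0; rewrite mmeasure0 msupp0 subrr idealr0.
have goodD p1 p2 : good p1 -> good p2 -> good (p1 + p2).
  move=> [q1 [le1 std1 P1]] [q2 [le2 std2 P2]]; exists (q1 + q2); split.
  - exact: mmeasureD_leq.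
  - by move=> m /msuppD_le; rewrite mem_cat => /orP[/std1|/std2].
  - by rewrite opprD addrACA rpredD.
have goodZ c p1 : good p1 -> good (c *: p1).
  move=> [q [le std Pq]]; exists (c *: q); split.
  - exact: leq_trans (mmeasureZ_le _ _ _) le.
  - by move=> m /msuppZ_le /std.
  - by rewrite -scalerBr -mul_mpolyC idealMr.
move=> /mmeasure_leP lep; rewrite (mpolyE p) -/(good _) big_seq.
apply: big_ind => // m /lep ltm; apply: goodZ.
have [std|/nonstd[f fP lef]] := boolP (standard M m).
  exists 'X_[m]; split; first by rewrite mmeasureX.
  - by move=> m'; rewrite msuppX inE => /eqP->.
  - by rewrite subrr idealr0.
have [|q [leq std Pq]] := IH ('X_[m] - f).
  by rewrite -mmeasureN opprB; apply: leq_trans lef _.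
exists q; split=> //; first exact: leq_trans leq _.
have -> : 'X_[m] - q = ('X_[m] - f - q) + f by rewrite addrAC subrK.
by rewrite rpredD.
Qed.

(** There are at most [2 ^ N] choices for the set of large exponents; outside it an exponent has at
    most [M] values, and on its at most [D] elements at most [B]. *)
Lemma card_standard M B : (0 < M)%N -> (0 < B)%N ->
  (#|[set a : {ffun 'I_N -> 'I_B} | (#|[set i | (M <= a i)%N]| <= D)%N]|
     <= 2 ^ N * M ^ N * B ^ D)%N.
Proof.
move=> M0 B0.
pose F (S : {set 'I_N}) := [set a : {ffun 'I_N -> 'I_B} | [set i | (M <= a i)%N] == S].
apply: leq_trans (_ : #|\bigcup_(S : {set 'I_N} | (#|S| <= D)%N) F S| <= _)%N.
  apply/subset_leq_card/fintype.subsetP => a; rewrite inE => leD.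
  by apply/bigcupP; exists [set i | (M <= a i)%N] => //; rewrite inE.
apply: leq_trans (_ : \sum_(S : {set 'I_N} | (#|S| <= D)%N) #|F S| <= _)%N.
  elim/big_rec2: _ => [|S b A _ le]; first by rewrite cards0.
  by apply: leq_trans (leq_card_setU _ _) _; rewrite leq_add2l.
apply: leq_trans (_ : \sum_(S : {set 'I_N} | (#|S| <= D)%N) M ^ N * B ^ D <= _)%N;
  last first.
  rewrite sum_nat_const -mulnA leq_mul2r; apply/orP; right.
  by rewrite -[in X in (2 ^ X)%N](card_ord N) -cardsT -card_powerset powersetT cardsT max_card.
apply: leq_sum => S leD.
pose fam i : pred 'I_B := fun b => (i \in S) || (b < M)%N.
apply: leq_trans (_ : #|family fam| <= _)%N.
  apply/subset_leq_card/fintype.subsetP => a; rewrite inE => /eqP defS.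
  apply/familyP => i; change ((i \in S) || (a i < M)%N).
  by rewrite -defS inE; case: leqP.
rewrite card_family foldrE big_map big_enum /=.
rewrite (bigID (mem S)) /= mulnC; apply: leq_mul.
  apply: leq_trans (_ : \prod_(i | i \notin S) M <= _)%N; last first.
    by rewrite prod_nat_const leq_pexp2l // -[X in (_ <= X)%N](card_ord N) max_card.
  apply: leq_prod => i /negPf iS; rewrite cardE -(size_map val) -[X in (_ <= X)%N](size_iota 0 M).
  apply: uniq_leq_size; first by rewrite map_inj_uniq ?enum_uniq //; apply: val_inj.
  move=> _ /mapP[b bF ->]; move: bF.
  by rewrite mem_enum unfold_in /fam iS mem_iota.
apply: leq_trans (_ : \prod_(i in S) B <= _)%N; last first.
  by rewrite prod_nat_const leq_pexp2l.
by apply: leq_prod => i _; rewrite -[X in (_ <= X)%N](card_ord B) max_card.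
Qed.

Lemma dependent_mod M B (T : finType) (y : T -> {mpoly k[N]}) :
  (forall m, ~~ standard M m -> leads (weight w) P (weight w m) 'X_[m]) ->
  (0 < M)%N -> (0 < B)%N -> (2 ^ N * M ^ N * B ^ D < #|T|)%N ->
  (forall t, mm (y t) <= B)%N ->
  exists2 a : T -> k, \sum_t a t *: y t \in (P : pred _) & exists t, a t != 0.
Proof.
move=> nonstd M0 B0 ltT ley.
set St := [set a : {ffun 'I_N -> 'I_B} | (#|[set i | (M <= a i)%N]| <= D)%N].
have ltSt : (#|St| < #|T|)%N := leq_ltn_trans (card_standard M0 B0) ltT.
have /fin_all_exists[q qP] t := standard_span nonstd (ley t).
(* Coefficients of the standard representatives [q t]: there are more rows than columns, so some
   nonzero combination of the rows vanishes. *)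
pose A := \matrix_(i < #|T|, j < #|St|)
  (q (enum_val i))@_[multinom (enum_val j i' : nat) | i' < N].
have /rowV0Pn[u /sub_kermxP uA u0] : kermx A != 0.
  rewrite -mxrank_eq0 mxrank_ker subn_eq0 -ltnNge.
  exact: leq_ltn_trans (rank_leq_col A) ltSt.
pose a t := u 0 (enum_rank t).
have sumq0 : \sum_t a t *: q t = 0.
  apply/mpolyP => m; rewrite mcoeff0 raddf_sum /=.
  (* As all weights are positive, a standard monomial of weight below [B] has exponents below [B]
     and is a column of [A]. Any other monomial occurs in no [q t]. *)
  have [/andP[std lt]|nm] := boolP (standard M m && (weight w m < B)%N).
    have ltB i : (m i < B)%N := leq_ltn_trans (leq_weight m i) lt.
    pose b := [ffun i => Ordinal (ltB i)].
    have bSt : b \in St.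
      rewrite inE; suff -> : [set i | (M <= b i)%N] = [set i | (M <= m i)%N] by [].
      by apply/setP => i; rewrite !inE ffunE.
    have /matrixP/(_ 0 (enum_rank_in bSt b)) := uA; rewrite !mxE => E; rewrite -[RHS]E.
    rewrite (reindex_onto enum_val enum_rank) /=; last by move=> *; apply: enum_rankK.
    rewrite (eq_bigl xpredT) => [|i]; last by rewrite enum_valK eqxx.
    apply: eq_bigr => i _; rewrite mcoeffZ mxE /a enum_valK; congr (_ * _@__).
    apply/mnmP => j; rewrite mnmE.
    by rewrite enum_rankK_in // ffunE.
  apply: big1 => t _; rewrite mcoeffZ.
  have [le std _] := qP t; suff /memN_msupp_eq0-> : m \notin msupp (q t) by rewrite mulr0.
  apply: contra nm => mq; rewrite std //=.
  by move/mmeasure_leP: le; apply.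
exists a.
  have -> : \sum_t a t *: y t = \sum_t a t *: (y t - q t).
    by under [RHS]eq_bigr do rewrite scalerBr; rewrite sumrB sumq0 subr0.
  apply: rpred_sum => t _; rewrite -mul_mpolyC; apply: idealMr.
  by have [] := qP t.
move/eqP: u0; apply: contra_notP => H; apply/rowP => i; rewrite mxE.
by apply: contra_notP H => /eqP ui; exists (enum_val i); rewrite /a enum_valK.
Qed.

End ChainBound.

Lemma chain_length_bound (k : fieldType) (N D e : nat) (w : 'I_N -> nat)
    (P : nat -> prime_idealr {mpoly k[N]}) :
  (forall i, (0 < w i)%N) ->
  (forall S : {set 'I_N}, (D < #|S|)%N ->
    exists m : 'X_{1..N}, (forall i, i \notin S -> m i = 0%N) /\
      leads (weight w) (P 0) (weight w m) 'X_[m]) ->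
  (forall i, (i < e)%N ->
     {subset (P i : pred _) <= (P i.+1 : pred _)} /\
     ~ {subset (P i.+1 : pred _) <= (P i : pred _)}) ->
  (e <= D)%N.
Proof.
move=> w_gt0 leadP chainP; rewrite leqNgt; apply/negP => ltDe.
have [M M0 nonstd] := nonstandard_lead leadP.
have [c H] := chain_independent (weight w) chainP.
(* For [s = K.+1] and [B = c.+1 * s], the bound of [card_standard] equals [K * s ^ D], which is less
   than [s ^ D.+1] and so than the number [s ^ e] of independent elements. *)
pose K := (2 ^ N * M ^ N * (c.+1) ^ D)%N.
have [T [y [cardT ley indep]]] := H K.+1.
have [|||a aP [t]] := dependent_mod (B := (c.+1 * K.+1)%N) w_gt0 nonstd M0 _ _ _ (y := y).
- by [].
- rewrite cardT expnMn mulnA -/K.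
  apply: leq_trans (_ : K.+1 ^ D.+1 <= _)%N; last by rewrite leq_pexp2l.
  by rewrite expnS ltn_pmul2r ?expn_gt0.
- by move=> t; apply: leq_trans (ley t) _; rewrite mulSn; lia.
by rewrite (indep a aP) eqxx.
Qed.

(** * Products of arcs *)

Section ProductOfArcs.
Variables (k : fieldType) (N : nat) (mf : measure N) (P : idealr {mpoly k[N]}).
Variables (I : finType) (m : nat) (b : I -> 'I_m.+1 -> {mpoly k[N]}) (d : I -> nat).
Hypothesis le_b : forall i s, (mmeasure mf (b i s) <= (d i).+1)%N.
Local Notation mu := (fun r : {ffun I -> 'I_m.+1} => \prod_i b i (r i)).
Hypothesis lead_coefs : forall l, (l <= m)%N ->
  leads mf P (\sum_i d i)%N (\sum_(r : {ffun I -> 'I_m.+1} | (\sum_i r i == l)%N) mu r).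

(* The square of a monomial [mu r] is, modulo the given relations, a sum of
   products [mu r * mu r'] with [r' <> r] of the same total order, each of them
   divisible by [mu (min r r')], which has smaller total order. *)
Lemma prod_arcs_nil (r : {ffun I -> 'I_m.+1}) :
  (\sum_i r i <= m)%N -> nil_leads mf P (\sum_i d i)%N (mu r).
Proof.
have le_mu r' : (mmeasure mf (mu r') <= (\sum_i d i).+1)%N.
  by apply: mmeasure_prod_leq.
have [l] := ubnP (\sum_i r i)%N; elim: l r => // l IH r; rewrite ltnS => lel lem.
apply: (nil_leadsX (i := 2)) => //.
have lead := lead_coefs lem.
rewrite (bigD1 r) //= in lead.
set R := (X in _ + X) in lead.
have -> : (\prod_i b i (r i)) ^+ 2 = mu r * (mu r + R) - mu r * R.
  by rewrite /= mulrDr addrK expr2.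
rewrite mul2n -addnn; apply: nil_leadsD.
  apply: leads_nil; last exact: leadsMl.
  rewrite -addSn; apply: mmeasureM_leq => //.
  apply: mmeasureD_leq => //; exact: mmeasure_sum_leq.
rewrite /R -mulrN -sumrN mulr_sumr; apply: nil_leads_sum => r' /andP[/eqP sumr' ner'].
pose rmin := [ffun i => if (r i <= r' i)%N then r i else r' i].
pose q := \prod_i b i (if (r i <= r' i)%N then r' i else r i).
have -> : mu r * - mu r' = - q * mu rmin.
  rewrite mulrN mulNr /q /= -!big_split /=; congr (- _); apply: eq_bigr => i _.
  by rewrite ffunE; case: ifP => // _; rewrite mulrC.
apply: nil_leadsMl; first by rewrite mmeasureN; apply: mmeasure_prod_leq => i _; apply: le_b.
have le_min i : (rmin i <= r i)%N by rewrite ffunE; case: (leqP (r i)) => // /ltnW.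
(* Equality would give [r <= r'] pointwise, and the equal totals would then force [r' = r]. *)
have lt_sum : (\sum_i rmin i < \sum_i r i)%N.
  rewrite ltn_neqAle leq_sum ?andbT // eq_sym; apply: contra ner' => /eqP eq_sum.
  have le_r i : (r i <= r' i)%N.
    have /eqP := eq_sum; rewrite eq_sym (leqif_sum (fun i _ => leqif_eq (le_min i))).
    by move=> /forall_inP/(_ i isT)/eqP; rewrite ffunE; case: (leqP (r i)) => // lti; lia.
  have /eqP := sumr'; rewrite eq_sym (leqif_sum (fun i _ => leqif_eq (le_r i))).
  move=> /forall_inP eqr; apply/eqP/ffunP => i; apply/val_inj/esym/eqP.
  exact: eqr.
apply: IH; last exact: leq_trans (ltnW lt_sum) lem.
exact: leq_trans lt_sum lel.
Qed.

End ProductOfArcs.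

Lemma coef_prod_arcs (R : comNzRingType) (I : finType) (m : nat)
    (b : I -> 'I_m.+1 -> R) l :
  (\prod_i \sum_s b i s *: 'X^s)`_l =
  \sum_(r : {ffun I -> 'I_m.+1} | (\sum_i r i == l)%N) \prod_i b i (r i).
Proof.
rewrite bigA_distr_bigA /= coef_sum [RHS]big_mkcond /=; apply: eq_bigr => r _.
have -> : \prod_i (b i (r i) *: 'X^(r i)) = (\prod_i b i (r i)) *: 'X^(\sum_i r i)%N.
  elim/big_rec3: _ => [|i x y z _ ->]; first by rewrite scale1r.
  by rewrite exprD -scalerAl -scalerAr scalerA.
by rewrite coefZ coefXn eq_sym; case: eqP => _; rewrite ?mulr1 ?mulr0.
Qed.

(** * Leading forms of the coefficients of the characteristic polynomial *)

Section AntidiagonalWeight.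
Variable n : nat.

(** The sum of c distinct naturals is at least 0 + ... + (c - 1); the induction removes the largest
    element, which is at least c - 1. *)
Lemma sum_ord_ge (S : {set 'I_n}) : (#|S| * #|S|.-1 <= 2 * \sum_(i in S) i)%N.
Proof.
have [c] := ubnP #|S|; elim: c S => // c IH S; rewrite ltnS => leSc.
have [->|[i0 i0S]] := set_0Vmem S; first by rewrite cards0.
case: (arg_maxnP (fun i : 'I_n => i : nat) i0S) => a aS amax.
have {}aS : a \in S := aS.
have leS : (#|S| <= a.+1)%N.
  rewrite cardE -(size_map val) -[X in (_ <= X)%N](size_iota 0 a.+1).
  apply: uniq_leq_size; first by rewrite map_inj_uniq ?enum_uniq //; apply: val_inj.
  by move=> _ /mapP[b bS ->]; rewrite mem_iota /= add0n ltnS; apply: amax; move: bS; rewrite mem_enum.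
have cardS := cardsD1 a S; rewrite aS add1n in cardS.
have := IH (S :\ a); rewrite -ltnS -cardS => /(_ leSc) leD.
rewrite (big_setD1 a) //= mulnDr.
move: leD; have -> : #|S :\ a| = #|S|.-1 by rewrite cardS.
move: (\sum_(i in _) _)%N; case: #|S| leS => [|[|c']] //= leS X leD.
by nia.
Qed.

(** The constant exceeds every [(i + j) ^ 2], so the subtraction is never truncated and the weights
    are positive. *)
Definition entry_weight (i j : 'I_n) : nat := ((2 * n) ^ 2).+1 - (i + j) ^ 2.

Lemma entry_weight_gt0 i j : (0 < entry_weight i j)%N.
Proof.
by rewrite /entry_weight subn_gt0 ltnS leq_exp2r //; have := ltn_ord i; have := ltn_ord j; lia.
Qed.

Lemma entry_weightE (i j : 'I_n) c : (i + j = c)%N -> entry_weight i j = (((2 * n) ^ 2).+1 - c ^ 2)%N.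
Proof. by move=> <-. Qed.

(* [sum_S (i + s i - (c - 1))^2 >= 0] together with
   [sum_S (i + s i) = 2 sum_S i >= c (c - 1)]. *)
Lemma antidiagonal_max (s : 'S_n) (S : {set 'I_n}) :
  perm_on S s -> ~~ [forall i in S, (i + s i == #|S|.-1)%N] ->
  (\sum_(i in S) entry_weight i (s i) < #|S| * (((2 * n) ^ 2).+1 - #|S|.-1 ^ 2))%N.
Proof.
move=> sS; rewrite negb_forall_in => /exists_inP[a aS anot].
set c := #|S|.-1; pose B := ((2 * n) ^ 2)%N.
have sum_s : (\sum_(i in S) s i = \sum_(i in S) i)%N.
  rewrite [RHS](reindex_inj (@perm_inj _ s)) /=; apply: eq_bigl => i.
  by rewrite perm_closed.
have le_x (i : 'I_n) : ((i + s i) ^ 2 <= B.+1)%N.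
  by apply: leqW; rewrite leq_exp2r //; have := ltn_ord i; have := ltn_ord (s i); lia.
have le_c : (c ^ 2 <= B.+1)%N.
  apply: leqW; rewrite leq_exp2r // /c.
  have : (#|S| <= n)%N by rewrite -[X in (_ <= X)%N](card_ord n) max_card.
  by lia.
have H1 : (\sum_(i in S) entry_weight i (s i) + \sum_(i in S) (i + s i) ^ 2 = #|S| * B.+1)%N.
  rewrite -big_split /= -sum_nat_const; apply: eq_bigr => i _.
  by rewrite /entry_weight subnK.
(* Termwise this is the nonnegativity of a square; it is strict at [a], where [a + s a] differs from
   [c]. *)
have H2 : (\sum_(i in S) 2 * ((i + s i) * c) < \sum_(i in S) ((i + s i) ^ 2 + c ^ 2))%N.
  rewrite (big_setD1 a) //= [X in (_ < X)%N](big_setD1 a) //= -addSn; apply: leq_add.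
    by rewrite (ltn_leqif (nat_Cauchy _ _)).
  by apply: leq_sum => i _; rewrite nat_Cauchy.
rewrite -big_distrr -big_distrl /= big_split /= sum_s in H2.
rewrite [X in (_ < X)%N]big_split /= sum_nat_const in H2.
have H3 := sum_ord_ge S; rewrite -/c in H3.
rewrite -/B mulnBr.
set W := (\sum_(i in S) entry_weight _ _)%N in H1 *; set X := (\sum_(i in S) (_ + _) ^ 2)%N in H1 H2.
set Y := (\sum_(i in S) i)%N in H2 H3.
have H4 : (2 * ((Y + Y) * c) >= 2 * (#|S| * c ^ 2))%N.
  rewrite leq_pmul2l // -mulnn mulnA; apply: leq_mul => //.
  by rewrite addnn -mul2n.
by move: H1 H2 H4; move: (#|S| * c ^ 2)%N (#|S| * _)%N ((Y + Y) * c)%N => z t v; lia.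
Qed.

End AntidiagonalWeight.

Section CharPolyLeadingForm.
Variables (k : fieldType) (N : nat) (mf : measure N).
Local Notation mm := (mmeasure mf).

Lemma mmeasure_coef_prod (T : finType) (Q : pred T) (F : T -> {poly {mpoly k[N]}})
    (d : T -> nat) :
  (forall i, Q i -> forall s, (mm (F i)`_s <= (d i).+1)%N) ->
  forall s, (mm (\prod_(i | Q i) F i)`_s <= (\sum_(i | Q i) d i).+1)%N.
Proof.
move=> H; elim/big_ind2: _ => //.
  by move=> s; rewrite coef1 -mpolyC_nat mmeasureC; case: (_ == _).
move=> p1 d1 p2 d2 le1 le2 s; rewrite coefM; apply: mmeasure_sum_leq => i _.
by rewrite -addSn; apply: mmeasureM_leq.
Qed.

Variable n : nat.

(** The permutation of the leading term: the antidiagonal of the top left block of size [c], and the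
    identity elsewhere. For [c <= n] the default of [insubd] is never reached. *)
Definition reflect_ord c (i : 'I_n) : 'I_n :=
  if (i < c)%N then insubd i (c.-1 - i)%N else i.

Lemma val_reflect_ord c (i : 'I_n) : (c <= n)%N ->
  reflect_ord c i = (if (i < c)%N then c.-1 - i else i)%N :> nat.
Proof.
by move=> len; rewrite /reflect_ord; case: ifP => // lti; rewrite val_insubd ifT //; lia.
Qed.

Lemma reflect_ordK c : (c <= n)%N -> involutive (reflect_ord c).
Proof.
by move=> len i; apply: val_inj => /=; rewrite !val_reflect_ord //; do !case: ifP => //; lia.
Qed.

(** Expand the Leibniz formula, with [S] the set of rows where the entry of [- U] is taken. The
    other rows contribute ['X], hence must be fixed by the permutation, and their number is the
    degree. *)
Lemma char_poly_coef (R : comNzRingType) (U : 'M[R]_n) l : (l <= n)%N ->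
  (char_poly U)`_l = \sum_(p : 'S_n * {set 'I_n} | perm_on p.2 p.1 && (#|p.2| == n - l)%N)
    (-1) ^+ p.1 * \prod_(i in p.2) - U i (p.1 i).
Proof.
move=> leln; rewrite /char_poly /determinant coef_sum.
transitivity (\sum_(s : 'S_n) \sum_(S : {set 'I_n})
  if perm_on S s && (#|S| == n - l)%N then (-1) ^+ s * \prod_(i in S) - U i (s i) else 0);
  last by rewrite pair_bigA [RHS]big_mkcond.
apply: eq_bigr => s _.
rewrite (eq_bigr (fun i => - (U i (s i))%:P + 'X *+ (i == s i))); last first.
  by move=> i _; rewrite !mxE addrC.
rewrite bigA_distr mulr_sumr coef_sum; apply: eq_bigr => S _.
have -> : (-1) ^+ s = ((-1) ^+ s)%:P :> {poly R} by rewrite rmorphXn rmorphN1.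
rewrite coefCM; case: (boolP (perm_on S s)) => /= [sS | nsS].
  rewrite (bigID (mem S)) /=.
  rewrite (eq_bigr (fun i => (- U i (s i))%:P)) => [|i ->]; last by rewrite rmorphN.
  have -> : \prod_(i | i \notin S) (if i \in S then - (U i (s i))%:P else 'X *+ (i == s i))
      = \prod_(i | i \notin S) 'X.
    by apply: eq_bigr => i iS; rewrite (negPf iS) (out_perm sS) // eqxx.
  rewrite prodr_const -rmorph_prod coefCM coefXn.
  have -> : (l == #|[predC S]|) = (#|S| == n - l)%N.
    have E : (#|S| + #|[predC S]| = n)%N by rewrite -[RHS](card_ord n) -(cardC (mem S)).
    by apply/eqP/eqP; lia.
  by case: eqP; rewrite ?mulr1 ?mulr0.
have [i si iS] : exists2 i, s i != i & i \notin S.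
  by have /subsetPn[i] := nsS; rewrite inE; exists i.
by rewrite (bigD1 i) //= (negPf iS) eq_sym (negPf si) mulr0n mul0r coef0 mulr0.
Qed.

Lemma char_poly_lead (U : 'M[{poly {mpoly k[N]}}]_n) l :
  (forall i j s, (mm (U i j)`_s <= (entry_weight i j).+1)%N) -> (l < n)%N ->
  exists (e : bool) R,
    (char_poly U)`_l = (-1) ^+ e * \prod_(i : 'I_n | (i < n - l)%N) U i (reflect_ord (n - l) i) + R /\
    forall s, (mm R`_s <= (n - l) * (((2 * n) ^ 2).+1 - (n - l).-1 ^ 2))%N.
Proof.
move=> le_U ltn; set c := (n - l)%N; have len : (c <= n)%N := leq_subr _ _.
pose s0 := perm (can_inj (reflect_ordK len)).
pose S0 := [set i : 'I_n | (i < c)%N].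
have cS0 : #|S0| = c.
  by rewrite cardsE -sum1_card (big_ord_narrow len) sum1_card card_ord.
rewrite (char_poly_coef _ (ltnW ltn)) (bigD1 (s0, S0)) /=; last first.
  rewrite cS0 eqxx andbT; apply/fintype.subsetP => i; rewrite inE permE inE.
  by apply: contraR => /negbTE nlt; rewrite /reflect_ord nlt.
rewrite prodrN cS0 mulrA -(signr_odd _ c) -signr_addb.
eexists; eexists; split; first by congr (_ * _ + _);
  apply: eq_big => i; rewrite ?inE // permE.
move=> s; rewrite coef_sum; apply: mmeasure_sum_leq => -[t S] /= /andP[/andP[tS /eqP cS] ne].
rewrite -/c in cS.
rewrite prodrN mulrA -(signr_odd _ #|S|) -signr_addb.
have sgn_coef (b : bool) (p : {poly {mpoly k[N]}}) : (mm ((-1) ^+ b * p)`_s = mm p`_s)%N.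
  by rewrite mulr_sign; case: b; rewrite ?coefN ?mmeasureN.
rewrite sgn_coef.
have H := mmeasure_coef_prod (Q := mem S) (F := fun i => U i (t i)) (fun i _ => le_U i (t i)) s.
apply: leq_trans H _; rewrite -cS; apply: antidiagonal_max => //.
(* If [i + t i = c - 1] on all of [S], then [S] consists of indices below [c], so equals [S0] by
   cardinality, and [t] is the reflection. *)
apply: contra ne => /forall_inP anti.
have ltc i : i \in S -> (i < c)%N.
  by move=> /anti /eqP; rewrite cS -/c; lia.
have eqS : S = S0.
  apply/eqP; rewrite eqEcard cS cS0 leqnn andbT; apply/fintype.subsetP => i.
  by rewrite inE; apply: ltc.
rewrite -pair_eqE /= eqS eqxx andbT; apply/eqP/permP => i; rewrite permE.
apply: val_inj; rewrite /= val_reflect_ord //.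
have [lti|geci] := ltnP i c.
  have /anti/eqP : i \in S by rewrite eqS inE.
  by rewrite cS => <-; rewrite addKn.
by rewrite (out_perm tS) // eqS inE -leqNgt.
Qed.

End CharPolyLeadingForm.

(** * Jets of a fiber of the Chevalley map *)

Section JetUpperBound.

Lemma find_leq_count (T : Type) (a : pred T) (s : seq T) :
  (find a s <= count (predC a) s)%N.
Proof. by elim: s => //= x s IH; case: (a x). Qed.

Lemma big_mxvec (R : Type) (idx : R) (op : Monoid.com_law idx) n1 n2
    (F : 'I_(n1 * n2) -> R) :
  \big[op/idx]_v F v = \big[op/idx]_i \big[op/idx]_j F (mxvec_index i j).
Proof.
rewrite pair_bigA /= (reindex _ (curry_mxvec_bij _ _)) /=.
by apply: eq_bigr => -[].
Qed.

Variables (n m : nat).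

Definition jet_index (i j : 'I_n) (s : 'I_m.+1) : 'I_(n * n * m.+1) :=
  mxvec_index (mxvec_index i j) s.

Definition jet_weight : 'I_(n * n * m.+1) -> nat :=
  mxvec (\matrix_(v < n * n, s < m.+1) mxvec (\matrix_(i, j) entry_weight i j) 0 v) 0.

Lemma jet_weightE i j s : jet_weight (jet_index i j s) = entry_weight i j.
Proof. by rewrite /jet_weight /jet_index mxvecE mxE mxvecE mxE. Qed.

Lemma jet_weight_gt0 v : (0 < jet_weight v)%N.
Proof.
case/mxvec_indexP: v => v s; case/mxvec_indexP: v => i j.
by rewrite -/(jet_index i j s) jet_weightE entry_weight_gt0.
Qed.

(** If no antidiagonal worked, each of the [n] antidiagonals would have at least [m.+1] variables
    outside [S]. As they are disjoint, [S] would miss at least [n * m.+1] variables. *)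
Lemma large_set_antidiagonal (S : {set 'I_(n * n * m.+1)}) :
  (n * n.-1 * m.+1 < #|S|)%N ->
  exists (c : 'I_n) (r : 'I_n -> 'I_m.+1),
    (\sum_(i : 'I_n | (i < c.+1)%N) r i <= m)%N /\
    forall i : 'I_n, (i < c.+1)%N -> jet_index i (reflect_ord c.+1 i) (r i) \in S.
Proof.
(* The least order whose variable lies in [S], or [m.+1] if there is none; all variables of smaller
   order lie outside [S]. *)
pose first i j := find (fun s => jet_index i j s \in S) (enum 'I_m.+1).
have first_le i j : (first i j <= \sum_s (jet_index i j s \notin S))%N.
  apply: leq_trans (find_leq_count _ _) _.
  by rewrite -sum1_count big_enum_cond /= big_mkcond leq_sum // => s _; case: (_ \in _).
move=> ltS; apply: contrapT => none.
have ge_c (c : 'I_n) : (m.+1 <= \sum_(i : 'I_n | (i < c.+1)%N) first i (reflect_ord c.+1 i))%N.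
  rewrite leqNgt; apply/negP => lt; apply: none.
  have lt_first (i : 'I_n) : (i < c.+1)%N -> (first i (reflect_ord c.+1 i) < m.+1)%N.
    by move=> lti; apply: leq_ltn_trans lt; rewrite (bigD1 i) //= leq_addr.
  exists c, (fun i => inord (first i (reflect_ord c.+1 i))); split.
    by rewrite -ltnS; apply: leq_ltn_trans lt; apply: leq_sum => i /lt_first ?; rewrite inordK.
  move=> i /lt_first lti.
  have hasS : has (fun s => jet_index i (reflect_ord c.+1 i) s \in S) (enum 'I_m.+1).
    by rewrite has_find size_enum_ord.
  have := nth_find ord0 hasS; set s := nth _ _ _; suff -> : inord (first i (reflect_ord c.+1 i)) = s by [].
  by apply: val_inj; rewrite /= inordK // nth_enum_ord.
have := ltS; rewrite ltnNge => /negP; apply.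
have cardS : (#|S| + \sum_i \sum_j \sum_s (jet_index i j s \notin S) = n * n * m.+1)%N.
  have -> : (\sum_i \sum_j \sum_s (jet_index i j s \notin S) = \sum_v (v \notin S))%N.
    by rewrite [RHS]big_mxvec [RHS]big_mxvec.
  rewrite -[in RHS](card_ord (n * n * m.+1)) -(cardC (mem S)); congr (_ + _)%N.
  by rewrite -sum1_card [RHS]big_mkcond; apply: eq_bigr => v _; rewrite inE; case: (v \in S).
suff : (n * m.+1 <= \sum_i \sum_j \sum_s (jet_index i j s \notin S))%N.
  have nE : (n * n * m.+1 = n * n.-1 * m.+1 + n * m.+1)%N.
    by rewrite -mulnDl; case: (n) => // n'; rewrite /= -mulnSr.
  by move: (etrans cardS nE); lia.
apply: leq_trans (_ : \sum_i \sum_j first i j <= _)%N; last first.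
  by apply: leq_sum => i _; apply: leq_sum => j _.
(* Exchange rows and antidiagonals: within row [i], distinct antidiagonals meet distinct columns. *)
apply: leq_trans (_ : \sum_(i < n) \sum_(c < n | (i < c.+1)%N) first i (reflect_ord c.+1 i) <= _)%N.
  rewrite (exchange_big_dep xpredT) //= -[X in (X * _)%N]card_ord -sum_nat_const.
  by apply: leq_sum => c _; apply: ge_c.
apply: leq_sum => i _; pose A := [set c : 'I_n | (i < c.+1)%N].
rewrite [X in (X <= _)%N](eq_bigl (fun c => c \in A)) => [|c]; last by rewrite inE.
rewrite -(big_imset (fun j => first i j)) /=; last first.
  move=> c1 c2; rewrite !inE => lt1 lt2 /(congr1 val) /=.
  rewrite !val_reflect_ord // lt1 lt2 /= => eq12; apply: val_inj => /=; lia.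
by rewrite [X in (_ <= X)%N](bigID (mem [set reflect_ord c.+1 i | c : 'I_n in A])) leq_addr.
Qed.

End JetUpperBound.

Definition jet_matrix (k : fieldType) (n m : nat) : 'M[{poly {mpoly k[n * n * m.+1]}}]_n :=
  \matrix_(i, j) @universal_jet k (n * n) m (mxvec_index i j).

Lemma weight1 N (w : 'I_N -> nat) i : weight w U_(i) = w i.
Proof.
rewrite /weight (bigD1 i) //= mnm1E eqxx mul1n big1 ?addn0 // => j ne.
by rewrite mnm1E eq_sym (negPf ne).
Qed.

Lemma jet_expand_chevalley (F k : fieldType) (h : {rmorphism F -> k}) n m l :
  jet_expand m (map_mpoly h (chevalley F n l)) = (char_poly (jet_matrix k n m))`_l.
Proof.
rewrite /jet_expand /chevalley -!coef_map !map_char_poly.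
congr (char_poly _)`_l; apply/matrixP => i j.
by rewrite !mxE /= map_mpolyX mmapX mmap1U.
Qed.

Lemma jet_matrix_weight (k : fieldType) n m (i j : 'I_n) s :
  (mmeasure (weight (@jet_weight n m)) (jet_matrix k n m i j)`_s <= (entry_weight i j).+1)%N.
Proof.
rewrite mxE coef_sum; apply: mmeasure_sum_leq => r _; rewrite coefZ coefXn.
rewrite -/(jet_index i j r); case: eqP => _; last by rewrite mulr0 mmeasure0.
by rewrite mulr1 mmeasureX /= weight1 jet_weightE.
Qed.

Section JetChain.
Variables (F k : fieldType) (h : {rmorphism F -> k}) (n m : nat) (a : 'I_n -> k).
Local Notation N := (n * n * m.+1)%N.
Local Notation wt := (weight (@jet_weight n m)).
Variable P : prime_idealr {mpoly k[N]}.
Hypothesis eqsP : forall (l : 'I_n) s, (s <= m)%N ->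
  (jet_expand m (map_mpoly h (chevalley F n l) - (a l)%:MP))`_s \in (P : pred _).

(** The equation for the coefficient of degree [n - c.+1] is, up to sign, the antidiagonal product
    plus terms of lower weight. The constant [a l] is among the latter, which makes the bound
    uniform over the fibers. *)
Lemma antidiagonal_leads (c : 'I_n) s : (s <= m)%N ->
  leads wt P (c.+1 * (((2 * n) ^ 2).+1 - c ^ 2))%N
    (\prod_(i : 'I_n | (i < c.+1)%N) jet_matrix k n m i (reflect_ord c.+1 i))`_s.
Proof.
move=> les; pose l := rev_ord c.
have nl : (n - l = c.+1)%N by rewrite /=; have := ltn_ord c; lia.
have [e [R [chE leR]]] := char_poly_lead (@jet_matrix_weight k n m) (ltn_ord l).
rewrite nl /= in chE leR; have := eqsP l les.
have -> p : jet_expand m (p - (a l)%:MP) = jet_expand m p - (a l)%:MP%:P.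
  by rewrite /jet_expand rmorphB /= mmapC.
rewrite coefB coefC.
rewrite jet_expand_chevalley chE coefD mulr_sign => inP.
set Q := \prod_(i | _) _ in inP *.
pose f : {mpoly k[N]} := (if e then - Q else Q)`_s + R`_s - (if s == 0%N then (a l)%:MP else 0).
exists ((-1) ^+ e * f); first exact: idealMr.
have -> : (-1) ^+ e * f - Q`_s = (-1) ^+ e * (R`_s - (if s == 0%N then (a l)%:MP else 0)).
  rewrite /f -addrA mulrDr !mulr_sign; by case: (e); rewrite ?coefN ?opprK addrAC subrr add0r.
(* The top weight is positive, so constants have strictly smaller weight. *)
have lec : (1 <= c.+1 * (((2 * n) ^ 2).+1 - c ^ 2))%N.
  rewrite muln_gt0 /= subn_gt0 ltnS leq_exp2r //; have := ltn_ord c; lia.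
rewrite mulr_sign; have -> : forall p : {mpoly k[N]}, mmeasure wt (if e then - p else p) = mmeasure wt p.
  by move=> p; case: (e); rewrite ?mmeasureN.
apply: mmeasureD_leq => //; rewrite mmeasureN.
case: eqP => _; last by rewrite mmeasure0.
by rewrite mmeasureC; case: eqP.
Qed.

(** A large [S] contains one variable from each arc of some antidiagonal, of total order at most
    [m]. By [prod_arcs_nil] a power of their product is a leading form. *)
Lemma jet_leading_monomial (S : {set 'I_N}) : (n * n.-1 * m.+1 < #|S|)%N ->
  exists mo : 'X_{1..N}, (forall v, v \notin S -> mo v = 0%N) /\
    leads wt P (wt mo) 'X_[mo].
Proof.
move=> /large_set_antidiagonal[c [r [sumr rS]]].
have lec : (c.+1 <= n)%N := ltn_ord c.
pose w := widen_ord lec.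
pose d (i : 'I_c.+1) := entry_weight (w i) (reflect_ord c.+1 (w i)).
pose X (i : 'I_c.+1) s : {mpoly k[N]} := 'X_(jet_index (w i) (reflect_ord c.+1 (w i)) s).
have sumd : (\sum_i d i = c.+1 * (((2 * n) ^ 2).+1 - c ^ 2))%N.
  rewrite -[X in (X * _)%N](card_ord c.+1) -sum_nat_const; apply: eq_bigr => i _.
  apply: entry_weightE; rewrite val_reflect_ord // (ltn_ord i : (w i < c.+1)%N) /=.
  by rewrite subnKC // -ltnS.
have le_X i s : (mmeasure wt (X i s) <= (d i).+1)%N.
  by rewrite mmeasureX /= weight1 jet_weightE.
have lead s : (s <= m)%N -> leads wt P (\sum_i d i)%N
    (\sum_(r : {ffun 'I_c.+1 -> 'I_m.+1} | (\sum_i r i == s)%N) \prod_i X i (r i)).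
  move=> les; rewrite sumd -coef_prod_arcs.
  have := antidiagonal_leads c les; rewrite (big_ord_narrow lec).
  suff -> : \prod_i \sum_s X i s *: 'X^s =
      \prod_i jet_matrix k n m (w i) (reflect_ord c.+1 (w i)) by [].
  by apply: eq_bigr => i _; rewrite mxE.
pose r' := [ffun i => r (w i)].
have [|_ [M]] := prod_arcs_nil le_X lead (r := r').
  by rewrite (big_ord_narrow lec) in sumr; under eq_bigr do rewrite ffunE.
pose mo := (\sum_i U_(jet_index (w i) (reflect_ord c.+1 (w i)) (r' i)))%MM.
have -> : \prod_i X i (r' i) = 'X_[mo].
  by rewrite /mo (big_morph _ (@mpolyXD _ _) (@mpolyX0 _ _)).
have -> : (\sum_i d i)%N = wt mo.
  rewrite /mo (big_morph wt (@weightD _ _) (@weight0 _ _)); apply: eq_bigr => i _.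
  by rewrite weight1 jet_weightE.
rewrite mpolyXn => leadM; exists (mo *+ M)%MM; split.
  move=> v vS; rewrite mulmnE (_ : mo v = 0%N) // /mo mnm_sumE big1 // => i _.
  rewrite mnm1E; case: eqP => // E; move: vS; rewrite -E ffunE rS //.
  exact: (ltn_ord i).
suff -> : wt (mo *+ M)%MM = (M * wt mo)%N by [].
rewrite /weight big_distrr /=; apply: eq_bigr => v _; rewrite mulmnE; lia.
Qed.

End JetChain.

Lemma jet_fiber_dim (F : fieldType) (n m : nat) (x : prime_idealr {mpoly F[n]}) e :
  has_chain (jet_scheme m (fiber (chevalley F n) x)) e -> (e <= n * n.-1 * m.+1)%N.
Proof.
move=> [Q [carrierQ chainQ]].
apply: (chain_length_bound (@jet_weight_gt0 n m) _ chainQ).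
apply: (@jet_leading_monomial F _ (residue x \o @mpolyC n F) n m (fun l => residue x 'X_l)).
move=> l s les; apply: (carrierQ 0%N isT).
apply/allpairsP; eexists (_, s); split; last reflexivity; last by rewrite mem_iota.
by rewrite /=; apply/mapP; exists l; rewrite ?mem_enum.
Qed.

(** * A chain of primes in a fiber *)

Section KernelPrime.
Variables (A : comNzRingType) (B : idomainType) (f : {rmorphism A -> B}).

Definition kernel_pred : pred A := fun a => f a == 0.

Fact kernel_idealr_closed : idealr_closed kernel_pred.
Proof.
split; rewrite ?unfold_in ?rmorph0 // ?rmorph1 ?oner_eq0 //.
move=> a u v; rewrite !unfold_in => /eqP fu /eqP fv.
by rewrite rmorphD rmorphM fu fv mulr0 addr0.
Qed.

Fact kernel_prime_closed : prime_idealr_closed kernel_pred.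
Proof. by move=> u v; rewrite !unfold_in rmorphM mulf_eq0. Qed.

HB.instance Definition _ := isIdealr.Build A kernel_pred kernel_idealr_closed.
HB.instance Definition _ := isPrimeIdealrClosed.Build A kernel_pred kernel_prime_closed.

Definition kernel_prime : prime_idealr A := kernel_pred.

Lemma mem_kernel a : (a \in (kernel_prime : pred A)) = (f a == 0).
Proof. by []. Qed.

End KernelPrime.

Lemma char_poly_conj (K : fieldType) n (G M C : 'M[K]_n) :
  \det G != 0 -> G *m M = C *m G -> char_poly M = char_poly C.
Proof.
move=> G0 GM.
have GM' : map_mx polyC G *m char_poly_mx M = char_poly_mx C *m map_mx polyC G.
  by rewrite mulmxBr mulmxBl -!map_mxM GM /= scalar_mxC.
have := congr1 determinant GM'; rewrite !det_mulmx mulrC det_map_mx => /mulIf; apply.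
by rewrite polyC_eq0.
Qed.

Lemma companion_exists (K : fieldType) n (p : {poly K}) : p \is monic -> size p = n.+1 ->
  exists C : 'M[K]_n, char_poly C = p /\
    forall (i : 'I_n) (lti : (i.+1 < n)%N), row i C = delta_mx 0 (Ordinal lti).
Proof.
move=> pm sp; have defn : n = (size p).-1 by rewrite sp.
move: sp => _; subst n; exists (companionmx p); split; first exact: companionmxK.
by move=> i lti; rewrite rowE mulmx_delta_companion.
Qed.

Lemma mpoly_rmorph_eq (k : nzRingType) q (A : comNzRingType) (f g : {rmorphism {mpoly k[q]} -> A}) :
  (forall c, f c%:MP = g c%:MP) -> (forall v, f 'X_v = g 'X_v) -> f =1 g.
Proof.
move=> fgC fgX p; elim/mpolyind: p => [|c m p _ _ IH]; first by rewrite !rmorph0.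
rewrite !rmorphD IH -mul_mpolyC !rmorphM fgC mpolyXE_id; congr (_ * _ + _).
by rewrite !rmorph_prod; apply: eq_bigr => v _; rewrite !rmorphXn fgX.
Qed.

(** * Conjugates of a companion matrix by a generic frame *)

Section GenericConjugate.
Variables (k : fieldType) (n' : nat).
Local Notation n := n'.+1.
Local Notation R := {mpoly k[n' * n]}.
Local Notation K := {fraction R}.
Variable C : 'M[k]_n.
Hypothesis C_shift : forall (i : 'I_n) (lti : (i.+1 < n)%N),
  row i C = delta_mx 0 (Ordinal lti).

Definition identity_entry : 'I_(n' * n) -> k :=
  mxvec (\matrix_(a < n', j < n) (lift ord0 a == j)%:R) 0.

Definition partial_spec (l : nat) (v : 'I_(n' * n)) : R :=
  if (v < l)%N then (identity_entry v)%:MP else 'X_v.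

Definition specialize_vars l : {rmorphism R -> R} :=
  locked (mmap (@mpolyC _ k) (partial_spec l) : {rmorphism R -> R}).

Definition frame l : 'M[R]_n :=
  \matrix_(i, j) if unlift ord0 i is Some a then partial_spec l (mxvec_index a j)
                 else (i == j)%:R.

Definition frac_const : {rmorphism k -> K} := @tofrac R \o @mpolyC _ k.

Definition frac_frame l : 'M[K]_n := map_mx (@tofrac R) (frame l).

Definition conj_mx l : 'M[K]_n := invmx (frac_frame l) *m map_mx frac_const C *m frac_frame l.

Definition conj_eval l : {rmorphism {mpoly k[n * n]} -> K} :=
  locked (mmap frac_const (mxvec (conj_mx l) 0) : {rmorphism {mpoly k[n * n]} -> K}).

Lemma specializeC l c : specialize_vars l c%:MP = c%:MP.
Proof. by rewrite /specialize_vars -lock /= mmapC. Qed.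

Lemma specializeX l v : specialize_vars l 'X_v = partial_spec l v.
Proof. by rewrite /specialize_vars -lock /= mmapX mmap1U. Qed.

Lemma specialize_frame l : map_mx (specialize_vars l) (frame 0) = frame l.
Proof.
apply/matrixP => i j; rewrite !mxE; case: unliftP => [a _|_]; last by rewrite rmorph_nat.
by rewrite {1}/partial_spec ltn0 specializeX.
Qed.

Lemma specialize_succ l p : specialize_vars l.+1 (specialize_vars l p) = specialize_vars l.+1 p.
Proof.
apply: (mpoly_rmorph_eq (f := specialize_vars l.+1 \o specialize_vars l)) => [c|v].
  by rewrite [LHS](congr1 (specialize_vars l.+1) (specializeC l c)).
rewrite [LHS](congr1 (specialize_vars l.+1) (specializeX l v)) specializeX.
rewrite /partial_spec; case: ifP => [lt|nlt]; first by rewrite specializeC ltnW.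
by rewrite specializeX.
Qed.

(** At the point [identity_entry] every frame becomes the identity matrix, whatever the stage
    [l]. *)
Lemma det_frame l : \det (frame l) != 0.
Proof.
have E : map_mx (meval identity_entry) (frame l) = 1%:M.
  apply/matrixP => i j; rewrite !mxE; case: unliftP => [a ->|->]; last first.
    by rewrite rmorph_nat.
  rewrite /partial_spec; case: ifP => _; rewrite ?mevalC ?mevalXU;
    by rewrite /identity_entry mxvecE mxE.
apply: contraTneq isT => d0; have := det_map_mx (meval identity_entry) (frame l).
by rewrite E det1 d0 rmorph0 => /eqP; rewrite oner_eq0.
Qed.

Lemma det_frac_frame l : \det (frac_frame l) = tofrac (\det (frame l)).
Proof. by rewrite det_map_mx. Qed.

Lemma det_frac_frame_neq0 l : \det (frac_frame l) != 0.
Proof. by rewrite det_frac_frame tofrac_eq0 det_frame. Qed.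

Lemma frac_frame_unit l : frac_frame l \in unitmx.
Proof. by rewrite unitmxE unitfE det_frac_frame_neq0. Qed.

Lemma frame_conj l : frac_frame l *m conj_mx l = map_mx frac_const C *m frac_frame l.
Proof. by rewrite /conj_mx -mulmxA mulKVmx ?frac_frame_unit. Qed.

Lemma char_poly_conj_mx l : char_poly (conj_mx l) = map_poly frac_const (char_poly C).
Proof. by rewrite (char_poly_conj (det_frac_frame_neq0 l) (frame_conj l)) map_char_poly. Qed.

Lemma conj_evalC l c : conj_eval l c%:MP = frac_const c.
Proof. by rewrite /conj_eval -lock /= mmapC. Qed.

Lemma conj_evalX l i j : conj_eval l 'X_(mxvec_index i j) = conj_mx l i j.
Proof. by rewrite /conj_eval -lock /= mmapX mmap1U mxvecE. Qed.

Lemma conj_eval_generic l : map_mx (conj_eval l) (generic_matrix k n) = conj_mx l.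
Proof. by apply/matrixP => i j; rewrite [LHS]mxE [X in conj_eval _ X]mxE conj_evalX. Qed.

(** Since the frame intertwines the conjugate with [C] and [C] shifts the basis rows, multiplying
    row [i] of the frame by the conjugate gives row [i.+1]; row 0 is the first basis vector. The
    conjugate thus determines the frame. *)
Lemma row_conj_mx l (i : 'I_n) : row 0 (conj_mx l ^+ i) = row i (frac_frame l).
Proof.
case: i => i; elim: i => [|i IH] lti.
  rewrite expr0; apply/rowP => j; rewrite !mxE; case: unliftP => [a E|E] /=.
    by have := congr1 val E.
  by rewrite rmorph_nat.
rewrite exprSr row_mul (IH (ltnW lti)) -row_mul frame_conj row_mul.
rewrite -map_row C_shift /= map_delta_mx -rowE; congr row; exact: val_inj.
Qed.

(* Clears the denominator [\det (frame l)], in a way that is natural in [l]. *)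
Lemma conj_eval_numer p : exists s (q : R), forall l,
  conj_eval l p * tofrac (\det (frame l)) ^+ s = tofrac (specialize_vars l q).
Proof.
pose good p := exists s (q : R), forall l,
  conj_eval l p * tofrac (\det (frame l)) ^+ s = tofrac (specialize_vars l q).
have specialize_det l : specialize_vars l (\det (frame 0)) = \det (frame l).
  by rewrite -det_map_mx specialize_frame.
have goodM p1 p2 : good p1 -> good p2 -> good (p1 * p2).
  move=> [s1 [q1 E1]] [s2 [q2 E2]]; exists (s1 + s2)%N, (q1 * q2) => l.
  by rewrite !rmorphM exprD mulrACA E1 E2.
have goodD p1 p2 : good p1 -> good p2 -> good (p1 + p2).
  move=> [s1 [q1 E1]] [s2 [q2 E2]].
  exists (s1 + s2)%N, (q1 * \det (frame 0) ^+ s2 + q2 * \det (frame 0) ^+ s1) => l.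
  rewrite !rmorphD !rmorphM !rmorphXn /= specialize_det -E1 -E2 mulrDl exprD !mulrA.
  by congr (_ + _); rewrite -!mulrA; congr (_ * _); rewrite mulrC.
have goodC c : good c%:MP.
  by exists 0%N, c%:MP => l; rewrite expr0 mulr1 conj_evalC specializeC.
have goodX v : good 'X_v.
  case/mxvec_indexP: v => i j.
  (* Replacing the inverse by the adjugate gives polynomial entries at the cost of one factor
     [\det]. *)
  exists 1%N, ((\adj (frame 0) *m map_mx (@mpolyC _ k) C *m frame 0) i j) => l.
  rewrite expr1 conj_evalX -det_frac_frame.
  have -> : specialize_vars l ((\adj (frame 0) *m map_mx (@mpolyC _ k) C *m frame 0) i j) =
      (map_mx (specialize_vars l) (\adj (frame 0) *m map_mx (@mpolyC _ k) C *m frame 0)) i j.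
    by rewrite [RHS]mxE.
  rewrite !map_mxM map_mx_adj specialize_frame.
  have -> : map_mx (specialize_vars l) (map_mx (@mpolyC _ k) C) = map_mx (@mpolyC _ k) C.
    by apply/matrixP => i' j'; rewrite !mxE specializeC.
  have -> : conj_mx l i j * \det (frac_frame l) = (\det (frac_frame l) *: conj_mx l) i j.
    by rewrite [RHS]mxE mulrC.
  rewrite /conj_mx /invmx frac_frame_unit -!scalemxAl scalerA mulfV ?det_frac_frame_neq0 // scale1r.
  rewrite /frac_frame -map_mx_adj (map_mx_comp (@mpolyC _ k) (@tofrac R) C).
  by rewrite -!map_mxM mxE.
rewrite -/(good p) (mpolyE p); elim/big_ind: _ => [|y z|m _]; [by rewrite -mpolyC0|exact: goodD|].
rewrite -mul_mpolyC; apply: (goodM) => //; rewrite mpolyXE_id.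
elim/big_ind: _ => [|y z|v _]; [by rewrite -mpolyC1|exact: goodM|].
by elim: (m v) => [|e IH]; rewrite ?expr0 -?mpolyC1 // exprS; apply: goodM.
Qed.

(** The ideal of the closure of the conjugates of [C] by frames whose first [l] free entries are
    fixed. *)
Definition conj_prime l : prime_idealr {mpoly k[n * n]} := kernel_prime (conj_eval l).

Lemma mem_conj_prime l p : (p \in (conj_prime l : pred _)) = (conj_eval l p == 0).
Proof. exact: (mem_kernel (conj_eval l)). Qed.

(** If [p] vanishes at stage [l], so does its numerator, hence also after one more specialization,
    where the denominator is still nonzero. *)
Lemma conj_prime_sub l : {subset (conj_prime l : pred _) <= (conj_prime l.+1 : pred _)}.
Proof.
move=> p pl; have /eqP p0 := etrans (esym (mem_conj_prime l p)) pl.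
apply: (etrans (mem_conj_prime l.+1 p)).
have [s [q E]] := conj_eval_numer p.
have q0 : specialize_vars l q = 0.
  have := E l; rewrite p0 mul0r => /esym/eqP.
  by rewrite tofrac_eq0 => /eqP.
have := E l.+1.
have -> : specialize_vars l.+1 q = 0.
  exact: etrans (esym (specialize_succ l q)) (etrans (congr1 (specialize_vars l.+1) q0) (rmorph0 _)).
rewrite tofrac0 => /eqP.
rewrite mulf_eq0 => /orP[//|].
move=> det0; case/negP: (expf_neq0 s (det_frac_frame_neq0 l.+1)).
by rewrite (det_frac_frame l.+1).
Qed.

Lemma conj_prime_neq l : (l < n' * n)%N ->
  ~ {subset (conj_prime l.+1 : pred _) <= (conj_prime l : pred _)}.
Proof.
move=> ltl sub; pose v := Ordinal ltl.
have [a [j defv]] : exists a j, v = mxvec_index a j by case/mxvec_indexP: v => a j; exists a, j.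
(* By [row_conj_mx], this polynomial evaluates to the frame entry [v] minus its specialized value:
   zero at stage [l.+1], but ['X_v] minus a constant at stage [l]. *)
pose p : {mpoly k[n * n]} := (generic_matrix k n ^+ lift ord0 a) 0 j - (identity_entry v)%:MP.
have evp l' : conj_eval l' p = tofrac (partial_spec l' v - (identity_entry v)%:MP).
  rewrite /p !rmorphB conj_evalC; congr (_ - _).
  have -> : conj_eval l' ((generic_matrix k n ^+ lift ord0 a) 0 j) =
      row 0 (map_mx (conj_eval l') (generic_matrix k n ^+ lift ord0 a)) 0 j by rewrite 2![RHS]mxE.
  rewrite rmorphXn; change (row 0 (map_mx (conj_eval l') (generic_matrix k n) ^+ lift ord0 a) 0 j = tofrac (partial_spec l' v)).
  rewrite conj_eval_generic.
  by rewrite row_conj_mx mxE mxE mxE liftK -defv.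
have : conj_eval l p == 0.
  apply: (etrans (esym (mem_conj_prime l p))); apply: sub.
  apply: (etrans (mem_conj_prime l.+1 p)).
  by rewrite evp /partial_spec /= ltnSn subrr tofrac0 eqxx.
rewrite evp /partial_spec /= ltnn tofrac_eq0 subr_eq0 => /eqP /(congr1 (fun q : R => q@_U_(v))).
rewrite mcoeffX eqxx mcoeffC.
by have -> : (U_(v) == 0)%MM = false; [apply/negP => /eqP /mnmP/(_ v); rewrite mnm1E eqxx mnm0E
  | rewrite mulr0 => /eqP; rewrite oner_eq0].
Qed.

End GenericConjugate.

(** Take for [C] the companion matrix of the polynomial given by [x]. Its conjugates keep that
    characteristic polynomial, so every [conj_prime] contains the equations of the fiber. *)
Lemma chevalley_fiber_chain (F : fieldType) (n : nat) (x : prime_idealr {mpoly F[n]}) :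
  (0 < n)%N -> has_chain (fiber (chevalley F n) x) (n * n.-1).
Proof.
case: n x => // n' x _.
pose k := residue_field x; pose q : {poly k} := \poly_(i < n'.+1) residue x 'X_(inord i).
have sizeq : (size q < size ('X^(n'.+1) : {poly k}))%N by rewrite size_polyXn ltnS size_poly.
have [||C [charC rowC]] := @companion_exists k n'.+1 ('X^(n'.+1) + q).
- by rewrite monicE lead_coefDl // lead_coefXn.
- by rewrite size_polyDl // size_polyXn.
exists (conj_prime C); split; last first.
  move=> i lti; split; first exact: conj_prime_sub.
  by apply: conj_prime_neq => //; rewrite mulnC.
move=> l _ f /mapP[i _ ->]; apply: (etrans (mem_conj_prime C l _)).
rewrite rmorphB conj_evalC subr_eq0; apply/eqP.
have := congr1 (fun p : {poly _} => p`_i) (char_poly_conj_mx C l).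
rewrite charC coef_map /= coefD coefXn ltn_eqF // add0r coef_poly ltn_ord inord_val => <-.
pose h : {rmorphism {mpoly F[n'.+1 * n'.+1]} -> _} :=
  conj_eval C l \o map_mpoly (residue x \o @mpolyC n'.+1 F).
rewrite -[LHS]/(h (chevalley F n'.+1 i)) /chevalley -coef_map map_char_poly.
congr (char_poly _)`_i; rewrite -conj_eval_generic.
by apply/matrixP => a b; rewrite [LHS]mxE [RHS]mxE !mxE /h /= map_mpolyX.
Qed.

(** * Comparison of dimensions *)

Section KrullDim.
Variables (k : fieldType) (X : affine_scheme k).
Local Open Scope ereal_scope.

Lemma krull_dim_le D : (forall e, has_chain X e -> (e <= D)%N) ->
  krull_dim X <= D%:Z%:E.
Proof.
move=> leD; rewrite /krull_dim /supremum; case: ifP => _; first exact: leNye.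
case: xgetP => [y _ [_ +]|_]; last exact: leNye.
by apply=> _ [e /leD le <-]; rewrite lee_fin lez_nat.
Qed.

Lemma krull_dim_ge d : has_chain X d -> d%:Z%:E <= krull_dim X.
Proof.
move=> chd; apply: ge_supremum_Nmem; last by exists d.
(* [supremum] is meaningful only if a least upper bound exists: it is the greatest chain length if
   these are bounded, and [+oo] otherwise. *)
have [[D leD]|unbounded] := pselect (exists D, forall e, has_chain X e -> (e <= D)%N).
  have exP : exists e, `[< has_chain X e >] by exists d; apply/asboolP.
  have ubP e : `[< has_chain X e >] -> (e <= D)%N by move=> /asboolP/leD.
  case: (ex_maxnP exP ubP) => M /asboolP chM maxM.
  exists M%:Z%:E; split; last by move=> y; apply; exists M.
  by move=> _ [e /asboolP/maxM le <-]; rewrite lee_fin lez_nat.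
exists +oo; split=> [y _|y ubY]; first exact: leey.
case: y ubY => [z|//|] ubY; last by have := ubY _ (ex_intro2 _ _ _ chd erefl).
case: unbounded; exists `|z|%N => e che.
have := ubY _ (ex_intro2 _ _ _ che erefl); rewrite lee_fin.
by lia.
Qed.

End KrullDim.

Theorem theoremB (F : finFieldType) (n : nat) (hn : (1 <= n)%N) :
  exists C : int,
    forall (x : prime_idealr {mpoly F[n]}) (m : nat),
      (krull_dim (jet_scheme m (fiber (chevalley F n) x))
         < m%:Z%:E * krull_dim (fiber (chevalley F n) x) + C%:E)%E.
Proof.
(* The jets have dimension at most [D * m.+1 = m * D + D], and the fiber has dimension at least [D];
   the added 1 makes the inequality strict. *)
pose D := (n * n.-1)%N; exists (D%:Z + 1) => x m.
have le_jet := krull_dim_le (@jet_fiber_dim F n m x).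
have ge_fiber := krull_dim_ge (chevalley_fiber_chain x hn).
apply: Order.POrderTheory.le_lt_trans le_jet _.
apply: (@Order.POrderTheory.lt_le_trans _ _ (m%:Z%:E * D%:Z%:E + (D%:Z + 1)%:E)%E).
  by rewrite -EFinM -EFinD lte_fin /D; lia.
by apply: leeD2r; apply: lee_wpmul2l ge_fiber; rewrite lee_fin.
Qed.
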